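(* Let $t_0<t_1$ be real numbers, $f\in PC([t_0,t_1],\mathbb{R})$, $0<\alpha\le 1$ and $\beta>0$. Let $T\subset[t_0,t_1]$ be the set of continuity points of $f$. Then for the equality $$\int_{t_0}^{t_1}(t_1-t)^{\beta-1}f(t)\,({}^{c}D^{\alpha}_{t_0+}h)(t)\,dt=0\qquad\text{for every } h\in PC^{\alpha}_0([t_0,t_1],\mathbb{R})$$ to hold it is necessary and sufficient that: 1) $(t_1-t)^{\beta-\alpha}f(t)=0$ for $t\in T$, if $\beta>\alpha>0$; 2) $f(t)=\frac{k}{\Gamma(\alpha)}(t_1-t)^{\alpha-\beta}$ for $t\in T$, for some constant $k\neq 0$, if $0<\beta\le\alpha\le 1$.
   Context: $PC([t_0,t_1],\mathbb{R}^n)$ is the set of piecewise continuous functions: continuous everywhere on $[t_0,t_1]$ except at finitely many points of the open interval $(t_0,t_1)$, where they have discontinuities of the first kind (finite one-sided limits). For $\alpha>0$ the left Riemann–Liouville integral is $(I^{\alpha}_{t_0+}\varphi)(t)=\frac{1}{\Gamma(\alpha)}\int_{t_0}^{t}(t-\tau)^{\alpha-1}\varphi(\tau)\,d\tau$. For $0<\alpha<1$ and continuous $\varphi$ the left Caputo derivative is $({}^{c}D^{\alpha}_{t_0+}\varphi)(t)=\frac{d}{dt}\big(I^{1-\alpha}_{t_0+}(\varphi(\cdot)-\varphi(t_0))\big)(t)$; for $\alpha=1$ it is the ordinary derivative. For $0<\alpha\le1$, $PC^{\alpha}([t_0,t_1],\mathbb{R}^n)$ is the set of all $\varphi\in C([t_0,t_1],\mathbb{R}^n)$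 of the form $\varphi(t)=\varphi(t_0)+(I^{\alpha}_{t_0+}\psi)(t)$, $t\in[t_0,t_1]$, with $\psi\in PC([t_0,t_1],\mathbb{R}^n)$; for such $\varphi$ one has ${}^{c}D^{\alpha}_{t_0+}\varphi=\psi$ at all continuity points of $\psi$. $PC^{\alpha}_0([t_0,t_1],\mathbb{R}^n)=\{\varphi\in PC^{\alpha}([t_0,t_1],\mathbb{R}^n):\varphi(t_0)=\varphi(t_1)=0\}$.
   Formalization: In item 2 the alternative ''f = 0 on T'' (that is, k = 0) is added, since f = 0 satisfies the integral equality for every h but is not of the stated form with k ≠ 0. *)

(* Defs.v *)
(* Functions on [t0, t1] are total functions R -> R of which
   only the values on [t0, t1] matter. *)
From HB Require Import structures.
From mathcomp Require Import all_boot all_order all_algebra.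
From mathcomp Require Import all_classical all_reals all_analysis.
Import Order.TTheory GRing.Theory Num.Theory.
Import numFieldNormedType.Exports.

Set Implicit Arguments.
Unset Strict Implicit.
Unset Printing Implicit Defensive.

Local Open Scope classical_set_scope.
Local Open Scope ring_scope.

(* Continuity relative to [t0, t1], hence one-sided at t0 and at t1. *)
Definition continuity_points (R : realType) (t0 t1 : R) (f : R -> R) : set R :=
  [set t | t0 <= t <= t1 /\ f @ within `[t0, t1] (nbhs t) --> f t].

Definition PC (R : realType) (t0 t1 : R) (f : R -> R) : Prop :=
  exists s : seq R,
    (forall t, t \in s -> t0 < t < t1) /\
    (forall t, t0 <= t <= t1 -> t \notin s -> continuity_points t0 t1 f t) /\
    (forall t, t \in s -> cvg (f @ t^'-) /\ cvg (f @ t^'+)).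

Definition Gamma (R : realType) (a : R) : R :=
  \int[@lebesgue_measure R]_(x in `[0, +oo[) (x `^ (a - 1) * expR (- x)).

Definition RL_integral (R : realType) (alpha t0 : R) (phi : R -> R) (t : R) : R :=
  (Gamma alpha)^-1 *
  \int[@lebesgue_measure R]_(tau in `[t0, t]) ((t - tau) `^ (alpha - 1) * phi tau).

(* Meant for 0 < alpha <= 1.  At a point where the derivative does not exist,
   the value is the library's default one; for phi in PC^alpha this concerns
   finitely many points of [t0, t1], the endpoints possibly included, since
   derive1 is two-sided. *)
Definition caputo (R : realType) (alpha t0 : R) (phi : R -> R) (t : R) : R :=
  if alpha < 1
  then derive1 (RL_integral (1 - alpha) t0 (fun tau => phi tau - phi t0)) t
  else derive1 phi t.

Definition PCalpha (R : realType) (alpha t0 t1 : R) (phi : R -> R) : Prop :=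
  {within `[t0, t1], continuous phi} /\
  exists2 psi : R -> R, PC t0 t1 psi &
    forall t, t0 <= t <= t1 -> phi t = phi t0 + RL_integral alpha t0 psi t.

Definition PCalpha0 (R : realType) (alpha t0 t1 : R) (phi : R -> R) : Prop :=
  [/\ PCalpha alpha t0 t1 phi, phi t0 = 0 & phi t1 = 0].

(* Main.v *)
(* Let psi be piecewise continuous and h = I^alpha psi.  Fubini and the
   substitution u = s + (t - s) v give I^(1-alpha) h = C * \int psi with
   C = B(alpha, 1 - alpha) / (Gamma(alpha) Gamma(1 - alpha)), so the Caputo
   derivative of h is C * psi off finitely many points.  With
   g(t) = (t1 - t)^(beta-1) f(t) and w(t) = (t1 - t)^(alpha-1), the identity
   says that \int g psi = 0 whenever \int w psi = 0.  Testing with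
   psi = 1_[t0, x] - \int_[t0, x] w / \int_[t0, t1] w gives
   \int_[t0, x] g = c \int_[t0, x] w for every x, hence g = c w by
   differentiation.  When alpha < beta, boundedness of f near t1 forces
   c = 0. *)
Require Import Defs.
From HB Require Import structures.
From mathcomp Require Import all_boot all_order all_algebra.
From mathcomp Require Import all_classical all_reals all_analysis.
From mathcomp Require Import measurable_realfun.
From mathcomp Require Import ring lra.
Import Order.TTheory GRing.Theory Num.Theory.
Import numFieldNormedType.Exports.
Local Open Scope classical_set_scope.
Local Open Scope ring_scope.

Set Implicit Arguments.
Unset Strict Implicit.
Unset Printing Implicit Defensive.

(** The boundary condition at t1 is itself the orthogonality relation: h(t1) = Gamma(alpha)^-1 *
    \int w psi, while h(t0) = 0 for every h = I^alpha psi. Functions psi with a single jump suffice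
    as tests, and I^alpha of such a psi has a closed form, which settles the continuity required of
    h. Kernels and weights may be unbounded at an end of the interval, and the real-valued integral
    of a non-integrable function carries no information. Integrability is therefore secured before
    linearity, Fubini or the fundamental theorem is used; on the line it comes from one domination,
    a bounded function times (t - u)^(a - 1) with a > 0. The relation between f and the power of t1
    - t is first obtained inside the interval only. Since jumps lie strictly inside, t0 and t1 are
    continuity points, and the values there follow as limits. *)

(** * Affine substitution and integrals of powers *)

(** The pushforward of Lebesgue measure scaled by [|k|] agrees with Lebesgue measure on half-open
    intervals, hence everywhere by uniqueness. Both signs of k occur: reflections as well as
    dilations are needed. *)
Lemma ge0_integral_affine (R : realType) (c k : R) (f : R -> \bar R) :
  k != 0 -> measurable_fun [set: R] f -> (forall x, (0 <= f x)%E) ->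
  (\int[lebesgue_measure]_x f x =
   `|k|%:E * \int[lebesgue_measure]_x f (c + k * x)%R)%E.
Proof.
move=> k0 mf f0.
pose phi : measurableTypeR R -> measurableTypeR R := fun x => c + k * x.
have mphi : measurable_fun setT phi.
  by apply: measurable_funD => //; exact: measurable_funM.
pose nu0 := mscale (NngNum (normr_ge0 k))
  (pushforward (@lebesgue_measure R) phi : {measure set _ -> \bar R}).
pose nu := nu0 mphi.
transitivity (\int[nu]_x f x)%E.
  apply: eq_measure_integral => A mA _.
  apply: lebesgue_measure_unique => // _ [[a b]] _ <-.
  change (lebesgue_measure `]a, b]%classic =
    (`|k|%:E * lebesgue_measure (phi @^-1` `]a, b]%classic))%E).
  have [kp|kn|ke] := ltgtP 0 k; last by rewrite -ke eqxx in k0.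
  - have -> : phi @^-1` `]a, b] = `](a - c) / k, (b - c) / k]%classic.
      apply/seteqP; split => x /=; rewrite /phi !in_itv/=.
        by move=> /andP[? ?]; rewrite ltr_pdivrMr// ler_pdivlMr//; apply/andP; split; lra.
      by rewrite ltr_pdivrMr// ler_pdivlMr// => /andP[? ?]; apply/andP; split; lra.
    rewrite !lebesgue_measure_itv/= !lte_fin ltr_pM2r ?invr_gt0// ltrD2r.
    case: ifPn => _; last by rewrite mule0.
    by rewrite -!EFinD -EFinM gtr0_norm//; congr EFin; field.
  - have -> : phi @^-1` `]a, b] = `[(b - c) / k, (a - c) / k[%classic.
      apply/seteqP; split => x /=; rewrite /phi !in_itv/=.
        by move=> /andP[? ?]; rewrite ler_ndivrMr// ltr_ndivlMr//; apply/andP; split; lra.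
      by rewrite ler_ndivrMr// ltr_ndivlMr// => /andP[? ?]; apply/andP; split; lra.
    rewrite !lebesgue_measure_itv/= !lte_fin ltr_nM2r ?invr_lt0// ltrD2r.
    case: ifPn => _; last by rewrite mule0.
    by rewrite -!EFinD -EFinM ltr0_norm//; congr EFin; field.
rewrite ge0_integral_mscale//= ge0_integral_pushforward//=.
Qed.

(* The maximum is needed because the library sets x `^ a = 1 for x < 0. *)
Lemma continuous_powR_max0 (R : realType) (a : R) : 0 < a ->
  continuous (fun x : R => Num.max x 0 `^ a).
Proof.
move=> a0 x; have [xp|xn|<-] := ltgtP 0 x.
- rewrite /continuous_at max_l ?ltW//.
  have cx : {for x, continuous (fun y : R => y `^ a)}.
    apply: differentiable_continuous; apply/derivable1_diffP.
    by apply: derivable_powR; rewrite in_itv/= andbT.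
  apply: cvg_trans cx; apply: near_eq_cvg; near=> y; rewrite max_l// ltW//.
  by near: y; exact: lt_nbhsr.
- rewrite /continuous_at max_r ?ltW//.
  have c0 : {for x, continuous (fun _ : R => 0 `^ a : R)} by exact: cst_continuous.
  apply: cvg_trans c0; apply: near_eq_cvg; near=> y; rewrite max_r// ltW//.
  by near: y; exact: lt_nbhsl.
- rewrite /continuous_at maxxx powR0 ?gt_eqF//.
  have /left_right_continuousP :
      (fun x : R => Num.max x 0 `^ a) x @[x --> (0:R)^'-] --> Num.max (0:R) 0 `^ a /\
      (fun x : R => Num.max x 0 `^ a) x @[x --> (0:R)^'+] --> Num.max (0:R) 0 `^ a.
    rewrite maxxx powR0 ?gt_eqF//; split.
      have c0 : {for (0:R), continuous (fun _ : R => 0 : R)} by exact: cst_continuous.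
      apply: cvg_trans (cvg_at_left_filter c0); apply: near_eq_cvg; near=> y.
      rewrite max_r ?powR0 ?gt_eqF//; near: y; exact: nbhs_left_le.
    apply: cvg_trans (powR_cvg0 a0); apply: near_eq_cvg; near=> y.
    by rewrite max_l//; near: y; exact: nbhs_right_ge.
  by rewrite maxxx powR0 ?gt_eqF//.
Unshelve. all: by end_near. Qed.

Lemma ge0_derivable_powR_LRcontinuous (R : realType) (a x y : R) :
  0 < x -> x < y -> derivable_oo_LRcontinuous (fun u : R => u `^ a / a) x y.
Proof.
move=> x0 xy.
have d u : 0 < u -> derivable (fun u : R => u `^ a / a) u 1.
  move=> u0; apply: derivableM => //.
  by apply: derivable_powR; rewrite in_itv/= andbT.
have c u : 0 < u -> {for u, continuous (fun u : R => u `^ a / a)}.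
  by move=> u0; apply: differentiable_continuous; exact/derivable1_diffP/d.
split.
- by move=> u; rewrite in_itv/= => /andP[xu _]; apply: d; exact: lt_trans xu.
- exact/cvg_at_right_filter/c.
- exact/cvg_at_left_filter/c/(lt_trans x0).
Qed.

(** For x = 0 and a < 1 the integrand is unbounded at 0, so the fundamental theorem is applied on
    intervals that stay away from x, and monotone convergence exhausts []x, y]]. *)
Lemma integral_powRB1 (R : realType) (a x y : R) : 0 < a -> 0 <= x -> x <= y ->
  (\int[lebesgue_measure]_(u in `[x, y]) (u `^ (a - 1))%:E =
   ((y `^ a - x `^ a) / a)%:E)%E.
Proof.
move=> a0 x0; rewrite le_eqVlt => /predU1P[<-|xy].
  by rewrite set_itv1 integral_set1 subrr mul0r.
(* The shift to [n.+1] keeps [e n] strictly below y: [harmonic 0] is 1 and would give a degenerate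
   interval. *)
pose e n : R := x + (y - x) * (harmonic n.+1).
have h1 n : harmonic n.+1 < 1 :> R by rewrite /= invf_lt1// ltr1n.
have ey n : e n < y.
  by rewrite /e -ltrBrDl -[ltRHS]mulr1 ltr_pM2l ?subr_gt0//.
have xe n : x < e n by rewrite /e ltrDl mulr_gt0// ?subr_gt0// harmonic_gt0.
have ecvg : e n @[n --> \oo] --> x.
  rewrite -[X in _ --> X]addr0 -[X in _ --> _ + X](mulr0 (y - x)).
  apply: cvgD; first exact: cvg_cst.
  apply: cvgM; first exact: cvg_cst.
  by have := @cvg_harmonic R; rewrite -cvg_shiftS.
pose E n : set R := `[e n, y]%classic.
have mp (D : set R) : measurable_fun D (fun u : R => (u `^ (a - 1))%:E).
  apply: measurable_funTS; apply/measurable_EFinP; exact: measurable_powR.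
rewrite -integral_itv_obnd_cbnd//.
have UE : `]x, y]%classic = \bigcup_n E n.
  apply/seteqP; split => [z|z [n _]]; rewrite /E/= !in_itv/=.
    move=> /andP[xz zy].
    have [n _ /(_ n) hn] := ecvg _ (lt_nbhsl xz).
    by exists n => //=; rewrite in_itv/= zy ltW//; apply: hn => /=.
  by move=> /andP[ez ->]; rewrite (lt_le_trans (xe n) ez).
rewrite UE; apply: (@cvg_unique _ (@ereal_hausdorff R)
  (\int[lebesgue_measure]_(u in E i) (u `^ (a - 1))%:E @[i --> \oo])%E).
  apply: ge0_nondecreasing_set_cvg_integral.
  - move=> m n mn; rewrite subsetEset => z; rewrite /E/= !in_itv/= => /andP[ez ->].
    rewrite andbT (le_trans _ ez)// /e lerD2l ler_wpM2l//=; first by rewrite subr_ge0 ltW.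
    by rewrite lef_pV2 ?posrE// ler_nat !ltnS.
  - by move=> i; exact: measurable_itv.
  - by move=> i; exact: mp.
  - by move=> i z _; rewrite lee_fin powR_ge0.
have intE n : (\int[lebesgue_measure]_(u in E n) (u `^ (a - 1))%:E =
    ((y `^ a - (e n) `^ a) / a)%:E)%E.
  have e0 : 0 < e n by exact: le_lt_trans (xe n).
  have dP u : e n < u -> derive1 (fun u : R => u `^ a / a) u = u `^ (a - 1).
    move=> eu; have u0 : 0 < u by exact: lt_trans eu.
    rewrite derive1E deriveMr; last first.
      by apply: derivable_powR; rewrite in_itv/= andbT.
    by rewrite -derive1E powR_derive1 ?in_itv/= ?andbT// mulrA mulVf ?mul1r ?gt_eqF.
  rewrite /E (@continuous_FTC2 _ _ (fun u : R => u `^ a / a))//.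
  - by rewrite -EFinB mulrBl.
  - apply: derivable_within_continuous => u; rewrite in_itv/= => /andP[eu _].
    by apply: derivable_powR; rewrite in_itv/= andbT (lt_le_trans e0).
  - exact: ge0_derivable_powR_LRcontinuous.
  - by move=> u; rewrite in_itv/= => /andP[eu _]; exact: dP.
rewrite (_ : (fun i => _) = (fun n => ((y `^ a - (e n) `^ a) / a)%:E)); last first.
  by apply/funext => n; exact: intE.
apply: cvg_EFin; first by near=> n.
apply: cvgM; last exact: cvg_cst.
have c := @continuous_powR_max0 R a a0 x.
apply: cvgB; first exact: cvg_cst.
have := cvg_comp _ _ ecvg c; rewrite max_l//; apply: cvg_trans.
apply: near_eq_cvg; near=> n => /=; rewrite max_l//.
by rewrite (le_trans x0)// ltW.
Unshelve. all: by end_near. Qed.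

Lemma integral_powRB1_reflect (R : realType) (a c d t : R) :
  0 < a -> c <= d -> d <= t ->
  (\int[lebesgue_measure]_(u in `[c, d]) ((t - u) `^ (a - 1))%:E =
   (((t - c) `^ a - (t - d) `^ a) / a)%:E)%E.
Proof.
move=> a0 cd dt.
rewrite -integral_powRB1 ?subr_ge0 ?lerD2l ?lerN2//.
pose D : set R := `[t - d, t - c]%classic.
have DE (u : R) : (t + -1 * u \in D) = (u \in `[c, d]%classic).
  rewrite /D !mem_setE !in_itv/=.
  by apply/idP/idP => /andP[? ?]; apply/andP; split; lra.
rewrite [RHS]integral_mkcond [LHS]integral_mkcond.
rewrite (@ge0_integral_affine R t (-1) ((fun u => (u `^ (a - 1))%:E) \_ D)).
- rewrite normrN1 mul1e; apply: eq_integral => u _.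
  by rewrite !patchE -/D DE mulN1r.
- by rewrite oppr_eq0 oner_eq0.
- apply/(measurable_restrictT _ _).1; first exact: measurable_itv.
  by apply: measurable_funTS; apply/measurable_EFinP; exact: measurable_powR.
- by move=> u; rewrite erestrict_ge0// => v _; rewrite lee_fin powR_ge0.
Qed.

(** * The Beta integral and positivity of Gamma *)

Definition beta_integral (R : realType) (a b : R) : \bar R :=
  (\int[lebesgue_measure]_(u in `[0%R, 1%R]) ((1 - u) `^ (b - 1) * u `^ (a - 1))%:E)%E.

Lemma measurable_powR_affine (R : realType) (a c k : R) (D : set R) :
  measurable_fun D (fun u : R => (c + k * u) `^ a).
Proof.
apply: measurable_funTS.
apply: (@measurableT_comp _ _ _ _ _ _ (@powR R ^~ a) _ (fun u : R => c + k * u)).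
  exact: measurable_powR.
by apply: measurable_funD => //; exact: measurable_funM.
Qed.

Lemma measurable_powR_subr (R : realType) (a c : R) (D : set R) :
  measurable_fun D (fun u : R => (c - u) `^ a).
Proof.
rewrite (_ : (fun _ => _) = (fun u : R => (c + -1 * u) `^ a)).
  exact: measurable_powR_affine.
by apply/funext => u; rewrite mulN1r.
Qed.

(** On each half of [0, 1] one of the two bases is at least 1/2, and its power, of exponent at least
    -1, is at most 2. The integrand is thus dominated by twice the sum of the two powers. *)
Lemma beta_integral_lty (R : realType) (a b : R) :
  0 < a <= 1 -> 0 < b <= 1 -> (beta_integral a b < +oo)%E.
Proof.
move=> /andP[a0 a1] /andP[b0 b1].
have half (x c : R) : 2^-1 <= x <= 1 -> 0 < c -> c <= 1 -> x `^ (c - 1) <= 2.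
  move=> /andP[x2 x1] c0 c1.
  have x0 : 0 < x by rewrite (lt_le_trans _ x2)// invr_gt0.
  apply: (@le_trans _ _ (x `^ (-1))).
    by apply: ger_powR; [rewrite x0|lra].
  by rewrite powR_inv1 ?(ltW x0)// -[X in _ <= X]invrK lef_pV2 ?posrE ?invr_gt0.
apply: (@le_lt_trans _ _ (\int[lebesgue_measure]_(u in `[0%R, 1%R])
  ((2 * (1 - u) `^ (b - 1))%:E + (2 * u `^ (a - 1))%:E))%E).
  apply: ge0_le_integral => //=.
  - by move=> u _; rewrite lee_fin mulr_ge0 ?powR_ge0.
  - apply/measurable_EFinP; apply: measurable_funM.
      exact: measurable_powR_subr.
    by apply: measurable_funTS; exact: measurable_powR.
  - apply/measurable_EFinP; apply: measurable_funD; apply: measurable_funM => //.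
      exact: measurable_powR_subr.
    by apply: measurable_funTS; exact: measurable_powR.
  - move=> u; rewrite in_itv/= => /andP[u0 u1]; rewrite -EFinD lee_fin.
    have p1 := powR_ge0 (1 - u) (b - 1); have p2 := powR_ge0 u (a - 1).
    have [u2|u2] := leP 2^-1 u.
      have : u `^ (a - 1) <= 2 by apply: half => //; rewrite u2.
      by nra.
    have : (1 - u) `^ (b - 1) <= 2 by apply: half => //; apply/andP; split; lra.
    by nra.
have I1 : (\int[lebesgue_measure]_(u in `[0%R, 1%R]) (2 * (1 - u) `^ (b - 1))%:E < +oo)%E.
  under eq_integral do rewrite EFinM.
  rewrite ge0_integralZl//=.
  - by rewrite integral_powRB1_reflect// -EFinM ltry.
  - by apply/measurable_EFinP; exact: measurable_powR_subr.
  - by move=> u _; rewrite lee_fin powR_ge0.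
have I2 : (\int[lebesgue_measure]_(u in `[0%R, 1%R]) (2 * u `^ (a - 1))%:E < +oo)%E.
  under eq_integral do rewrite EFinM.
  rewrite ge0_integralZl//=.
  - by rewrite integral_powRB1// -EFinM ltry.
  - by apply/measurable_EFinP; apply: measurable_funTS; exact: measurable_powR.
  - by move=> u _; rewrite lee_fin powR_ge0.
rewrite ge0_integralD//=.
- by rewrite lte_add_pinfty.
- by move=> u _; rewrite lee_fin mulr_ge0 ?powR_ge0.
- apply/measurable_EFinP; apply: measurable_funM => //.
  exact: measurable_powR_subr.
- by move=> u _; rewrite lee_fin mulr_ge0 ?powR_ge0.
- apply/measurable_EFinP; apply: measurable_funM => //.
  by apply: measurable_funTS; exact: measurable_powR.
Qed.

Lemma powRB1_ge1 (R : realType) (a x : R) : 0 < x <= 1 -> a <= 1 -> 1 <= x `^ (a - 1).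
Proof. by move=> x01 a1; rewrite -[X in X <= _](powRr0 x); apply: ger_powR => //; lra. Qed.

(** Both factors are at least 1 inside the interval. With finiteness, this makes [fine] of the
    integral positive. *)
Lemma beta_integral_ge1 (R : realType) (a b : R) :
  a <= 1 -> b <= 1 -> (1 <= beta_integral a b)%E.
Proof.
move=> a1 b1.
(* The endpoints are dropped because 0 to a nonzero power is 0, which would break the pointwise
   bound there. *)
rewrite /beta_integral (@integral_itv_bndoo R 0 1); last first.
  apply/measurable_EFinP; apply: measurable_funM.
    exact: measurable_powR_subr.
  by apply: measurable_funTS; exact: measurable_powR.
rewrite (_ : 1%E = \int[@lebesgue_measure R]_(u in `]0%R, 1%R[) (cst 1 u))%E; last first.
  by rewrite integral_cst//= mul1e lebesgue_measure_itv/= lte_fin ltr01 sube0.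
apply: ge0_le_integral => //=.
- apply/measurable_EFinP; apply: measurable_funM.
    exact: measurable_powR_subr.
  by apply: measurable_funTS; exact: measurable_powR.
- move=> u; rewrite in_itv/= => /andP[u0 u1]; rewrite lee_fin.
  by rewrite mulr_ege1// powRB1_ge1//; apply/andP; split; lra.
Qed.

(** The substitution produces (t - s)^(a + b - 2) from the powers and t - s from the Jacobian; these
    cancel exactly when a + b = 1, so the value depends on neither s nor t. *)
Lemma integral_beta_kernel (R : realType) (a b s t : R) : s < t -> a + b = 1 ->
  (\int[lebesgue_measure]_(u in `[s, t]) ((t - u) `^ (b - 1) * (u - s) `^ (a - 1))%:E =
   beta_integral a b)%E.
Proof.
move=> st ab.
have ts0 : 0 < t - s by rewrite subr_gt0.
pose f := (fun u : R => ((t - u) `^ (b - 1) * (u - s) `^ (a - 1))%:E) \_ `[s, t].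
have f0 u : (0 <= f u)%E.
  by rewrite erestrict_ge0// => v _; rewrite lee_fin mulr_ge0 ?powR_ge0.
have mf : measurable_fun [set: R] f.
  apply/(measurable_restrictT _ _).1; first exact: measurable_itv.
  apply/measurable_EFinP; apply: measurable_funM.
    exact: measurable_powR_subr.
  rewrite (_ : (fun _ => _) = (fun u : R => (- s + 1 * u) `^ (a - 1))).
    exact: measurable_powR_affine.
  by apply/funext => u; rewrite mul1r addrC.
rewrite [LHS]integral_mkcond -/f (@ge0_integral_affine R s (t - s) f) ?gt_eqF//.
rewrite -ge0_integralZl//=; last first.
  apply: (measurableT_comp mf).
  by apply: measurable_funD => //; exact: measurable_funM.
rewrite [RHS]integral_mkcond; apply: eq_integral => u _.
rewrite /f !patchE.
have -> : (s + (t - s) * u \in `[s, t]%classic) = (u \in `[0, 1]%classic).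
  rewrite !mem_setE !in_itv/=.
  by apply/idP/idP => /andP[? ?]; apply/andP; split; nra.
case: ifPn => [|_]; last by rewrite mule0.
rewrite inE/= in_itv/= => /andP[u0 u1].
rewrite -EFinM gtr0_norm//; congr EFin.
have -> : t - (s + (t - s) * u) = (t - s) * (1 - u) by ring.
have -> : s + (t - s) * u - s = (t - s) * u by ring.
rewrite !powRM ?subr_ge0// ?(ltW ts0) ?(ltW st)//.
have pp : (t - s) `^ (b - 1) * (t - s) `^ (a - 1) = (t - s)^-1.
  have ne : t - s != 0 by rewrite gt_eqF.
  rewrite -powRD; last by rewrite ne implybT.
  rewrite -(powR_inv1 (ltW ts0)); congr powR; lra.
by rewrite mulrACA pp mulVKf// gt_eqF.
Qed.

(** Convergence is part of the claim, since [fine] sends an infinite integral to 0. The integrand is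
    at most x^(a - 1) up to 1 and at most e^(-x) beyond, and at least e^(-1) on []0, 1]]. *)
Lemma Gamma_gt0 (R : realType) (a : R) : 0 < a -> a <= 1 -> 0 < Gamma a.
Proof.
move=> a0 a1; rewrite /Gamma /Rintegral.
pose g (x : R) := (x `^ (a - 1) * expR (- x)).
have g0 x : 0 <= g x by rewrite mulr_ge0 ?powR_ge0 ?expR_ge0.
have mexp (D : set R) : measurable_fun D (fun x : R => expR (- x)).
  apply: measurable_funTS.
  by apply: (measurableT_comp (@measurable_expR R)); exact: oppr_measurable.
have mexpE (D : set R) : measurable_fun D (fun x : R => (expR (- x))%:E).
  exact/measurable_EFinP.
have mg (D : set R) : measurable_fun D (fun x : R => (g x)%:E).
  apply/measurable_EFinP; apply: measurable_funM => //.
  by apply: measurable_funTS; exact: measurable_powR.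
apply: fine_gt0; apply/andP; split.
  apply: (@lt_le_trans _ _ (\int[@lebesgue_measure R]_(u in `]0%R, 1%R]) (cst (expR (-1))%:E u))%E).
    rewrite integral_cst//= lebesgue_measure_itv/= lte_fin ltr01 sube0 mule1.
    by rewrite lte_fin expR_gt0.
  apply: (@le_trans _ _ (\int[@lebesgue_measure R]_(u in `]0%R, 1%R]) (g u)%:E)%E).
    apply: ge0_le_integral => //=.
      - exact: mg.
    - move=> u; rewrite in_itv/= => /andP[u0 u1]; rewrite lee_fin /g.
      rewrite -[X in X <= _]mul1r ler_pM ?expR_ge0// ?powRB1_ge1 ?u0//.
      by rewrite ler_expR lerN2.
  apply: ge0_subset_integral => //=.
  - exact: mg.
  - by move=> x _; rewrite lee_fin; exact: g0.
  - by move=> x/=; rewrite !in_itv/= => /andP[/ltW ->].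
have exp1 : (\int[@lebesgue_measure R]_(x in `[0%R, +oo[) (expR (- x))%:E < +oo)%E.
  rewrite integral_mkcond; have := @integral_exponential_pdf R 1 ltr01.
  rewrite (_ : (\int[lebesgue_measure]_x (exponential_pdf 1 x)%:E =
      \int[lebesgue_measure]_x ((fun x => (expR (- x))%:E) \_ `[0%R, +oo[) x)%E); last first.
    apply: eq_integral => x _; rewrite /exponential_pdf !patchE.
    by case: ifPn => // _; rewrite mul1r mulN1r.
  by move=> ->; rewrite ltry.
apply: (@le_lt_trans _ _ (\int[@lebesgue_measure R]_(x in `[0%R, 1%R]) (g x)%:E +
   \int[@lebesgue_measure R]_(x in `]1%R, +oo[) (g x)%:E)%E).
  rewrite -ge0_integral_setU//=.
  - apply: ge0_subset_integral => //=.
    + exact: measurableU.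
    + exact: mg.
    + by move=> x _; rewrite lee_fin; exact: g0.
    + move=> x /=; rewrite !in_itv/= !andbT => x0.
      by have [x1|x1] := leP x 1; [left; rewrite x0|right].
  - exact: mg.
  - by move=> x _; rewrite lee_fin; exact: g0.
  - apply/disj_setPLR => x /=; rewrite !in_itv/= andbT => /andP[_ x1].
    by apply/negP; rewrite -leNgt.
rewrite lte_add_pinfty//.
  apply: (@le_lt_trans _ _ (\int[@lebesgue_measure R]_(x in `[0%R, 1%R]) (x `^ (a - 1))%:E)%E).
    apply: ge0_le_integral => //=.
    - by move=> u _; rewrite lee_fin; exact: g0.
    - exact: mg.
    - by apply/measurable_EFinP; apply: measurable_funTS; exact: measurable_powR.
    - move=> u; rewrite in_itv/= => /andP[u0 u1]; rewrite lee_fin /g.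
      by rewrite ler_piMr ?powR_ge0// -expR0 ler_expR; lra.
  by rewrite integral_powRB1// ltry.
apply: le_lt_trans exp1.
apply: (@le_trans _ _ (\int[@lebesgue_measure R]_(x in `]1%R, +oo[) (expR (- x))%:E)%E).
  apply: ge0_le_integral => //=.
  - by move=> u _; rewrite lee_fin; exact: g0.
  - exact: mg.
  - exact: mexpE.
  - move=> u; rewrite in_itv/= andbT => u1; rewrite lee_fin /g.
    rewrite ler_piMl ?expR_ge0//.
    by rewrite -[X in _ <= X](powRr0 u); apply: ler_powR; lra.
apply: ge0_subset_integral => //=.
- exact: mexpE.
- by move=> x /=; rewrite !in_itv/= !andbT => /ltW; apply: le_trans.
Qed.

(** * Piecewise continuous functions *)

Lemma measurable_subset_seq (R : realType) (s : seq R) (A : set R) :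
  A `<=` [set` s] -> measurable A.
Proof.
move=> As; apply: countable_measurable => [t|]; first exact: measurable_set1.
by apply: finite_set_countable; apply: sub_finite_set As _; exact: finite_seq.
Qed.

Lemma measurable_fun_setD_seq (R : realType) (D : set R) (s : seq R) (f : R -> R) :
  measurable D -> measurable_fun (D `\` [set` s]) f -> measurable_fun D f.
Proof.
move=> mD mf; rewrite -(setUIDK D [set` s]) setUC.
have ms : measurable (D `&` [set` s]).
  by apply: (@measurable_subset_seq _ s) => x [].
apply/measurable_funU => //.
  by apply: measurableD => //; exact: (@measurable_subset_seq _ s).
split => // _ Y mY; apply: (@measurable_subset_seq _ s).
by move=> x [[]].
Qed.

(** Measurability of f is deduced from that of g, so f may take arbitrary values on [s]. This
    absorbs the default values of [caputo]. *)
Lemma Rintegral_eq_setD_seq (R : realType) (D : set R) (s : seq R) (f g : R -> R) :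
  measurable D -> measurable_fun D g ->
  (forall x, D x -> x \notin s -> f x = g x) ->
  \int[@lebesgue_measure R]_(x in D) f x = \int[@lebesgue_measure R]_(x in D) g x.
Proof.
move=> mD mg fg.
have ms : measurable [set` s] by exact: (@measurable_subset_seq _ s).
have mf : measurable_fun D f.
  apply: (@measurable_fun_setD_seq _ _ s) => //.
  apply: (@eq_measurable_fun _ _ _ _ _ g); last first.
    by apply: measurable_funS mg => // x [].
  by move=> x; rewrite inE => -[Dx /= /negP xs]; rewrite fg.
congr fine; apply: ae_eq_integral => //; [exact/measurable_EFinP|exact/measurable_EFinP|].
exists [set` s]; split => //.
  by apply: countable_lebesgue_measure0; apply: finite_set_countable; exact: finite_seq.
move=> x /= nfg; apply: contrapT => /negP xs.
by apply: nfg => Dx; rewrite fg.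
Qed.

Lemma continuity_points_continuous (R : realType) (t0 t1 t : R) (f : R -> R) :
  t0 < t < t1 -> continuity_points t0 t1 f t -> {for t, continuous f}.
Proof.
move=> /andP[t0t tt1] [_ cf] A /cf fA; change (\forall y \near t, A (f y)).
have {}fA : \forall y \near t, t0 <= y <= t1 -> A (f y) by exact: fA.
apply: filterS3 fA (lt_nbhsr t0t) (lt_nbhsl tt1) => y + t0y yt1; apply.
by rewrite !ltW.
Qed.

Lemma near_le_norm_cvg (R : realType) (T : Type) (F : set_system T) (f : T -> R) (l : R) :
  Filter F -> f @ F --> l -> \forall y \near F, `|f y| <= `|l| + 1.
Proof.
move=> FF /cvgrPdist_lt/(_ 1 ltr01); apply: filterS => y h.
rewrite -lerBlDl; apply: le_trans (ltW h); rewrite distrC; exact: lerB_dist.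
Qed.

Lemma PC_locally_bounded (R : realType) (t0 t1 : R) (f : R -> R) (x : R) :
  PC t0 t1 f -> t0 <= x <= t1 ->
  exists M : R, \forall y \near x, t0 <= y <= t1 -> `|f y| <= M.
Proof.
move=> [s [sin [sC sJ]]] xt.
have [xs|xs] := boolP (x \in s); last first.
  have [_ cf] := sC _ xt xs.
  by exists (`|f x| + 1); exact: (near_le_norm_cvg _ cf).
have [/cvg_ex[/= l fl] /cvg_ex[/= r fr]] := sJ _ xs.
have hl := near_le_norm_cvg _ fl; have hr := near_le_norm_cvg _ fr.
exists (`|f x| + `|l| + `|r| + 1).
have {}hl : \forall y \near x, y < x -> `|f y| <= `|l| + 1 by exact: hl.
have {}hr : \forall y \near x, x < y -> `|f y| <= `|r| + 1 by exact: hr.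
apply: filterS2 hl hr => y hl hr _.
have n1 := normr_ge0 (f x); have n2 := normr_ge0 l; have n3 := normr_ge0 r.
have [/hl yx|/hr yx|->] := ltgtP y x; lra.
Qed.

(** Compactness is used in its near-covering form with the filter of bounds M tending to +oo: a
    local bound holds for all large M, so the local bounds merge without extracting a finite
    subcover. *)
Lemma PC_bounded (R : realType) (t0 t1 : R) (f : R -> R) :
  PC t0 t1 f -> exists M : R, forall t, t0 <= t <= t1 -> `|f t| <= M.
Proof.
move=> PCf.
have := @segment_compact R t0 t1; rewrite compact_near_coveringP => cov.
have [M [_ MP]] : \forall M \near +oo, `[t0, t1]%classic `<=`
    (fun y => t0 <= y <= t1 -> `|f y| <= M).
  apply: cov => x; rewrite /= in_itv/= => xt.
  have [M0 hM0] := PC_locally_bounded PCf xt.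
  exists ([set y : R | t0 <= y <= t1 -> `|f y| <= M0], [set M : R | M0 <= M]).
    by split => //=; exact: nbhs_pinfty_ge (num_real _).
  by move=> [y M] /= [h MM] yt; exact: le_trans (h yt) MM.
exists (M + 1) => t tt; have M1 : M < M + 1 by rewrite ltrDl.
by apply: (MP _ M1) => //; rewrite /= in_itv.
Qed.

Lemma PC_measurable (R : realType) (t0 t1 : R) (f : R -> R) :
  PC t0 t1 f -> measurable_fun `[t0, t1] f.
Proof.
move=> [s [sin [sC sJ]]]; apply: (@measurable_fun_setD_seq _ _ s) => //.
apply: subspace_continuous_measurable_fun.
  by apply: measurableD => //; exact: (@measurable_subset_seq _ s).
apply/subspace_continuousP => x [/=]; rewrite in_itv/= => xt /negP xs.
have [_ cf] := sC _ xt xs.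
by apply: cvg_trans cf; apply: cvg_app; apply: within_subset => y [].
Qed.

Lemma near_notin (R : realType) (s : seq R) (t : R) :
  t \notin s -> \forall x \near t, x \notin s.
Proof.
elim: s => [_|y s IH]; first exact: filterE.
rewrite inE negb_or => /andP[ty /IH]; apply: filterS2 (open_neq ty).
by move=> x xy xs; rewrite inE negb_or xs andbT.
Qed.

Lemma PC_near_left (R : realType) (t0 t1 : R) (f : R -> R) : t0 < t1 -> PC t0 t1 f ->
  \forall x \near t1^'-, continuity_points t0 t1 f x /\ t0 < x < t1.
Proof.
move=> t01 [s [sin [sC _]]]; near=> x.
have xt : t0 < x < t1.
  by apply/andP; split; near: x; [exact: nbhs_left_gt|exact: nbhs_left_lt].
split => //; case/andP: (xt) => *; apply: sC; first by rewrite !ltW.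
near: x; apply: cvg_at_left_filter (fun _ => id) _ _; apply: near_notin.
by apply/negP => /sin; rewrite ltxx andbF.
Unshelve. all: by end_near. Qed.

Lemma PC_near_right (R : realType) (t0 t1 : R) (f : R -> R) : t0 < t1 -> PC t0 t1 f ->
  \forall x \near t0^'+, continuity_points t0 t1 f x /\ t0 < x < t1.
Proof.
move=> t01 [s [sin [sC _]]]; near=> x.
have xt : t0 < x < t1.
  by apply/andP; split; near: x; [exact: nbhs_right_gt|exact: nbhs_right_lt].
split => //; case/andP: (xt) => *; apply: sC; first by rewrite !ltW.
near: x; apply: cvg_at_right_filter (fun _ => id) _ _; apply: near_notin.
by apply/negP => /sin; rewrite ltxx.
Unshelve. all: by end_near. Qed.

Lemma PC_cvg_left (R : realType) (t0 t1 : R) (f : R -> R) : t0 < t1 -> PC t0 t1 f ->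
  f x @[x --> t1^'-] --> f t1.
Proof.
move=> t01 [s [sin [sC _]]].
have [|//|_ cf] := sC t1 _ _; first by rewrite lexx ltW.
  by apply/negP => /sin; rewrite ltxx andbF.
move=> A /cf fA; change (\forall x \near t1^'-, A (f x)).
have {}fA : \forall y \near t1, t0 <= y <= t1 -> A (f y) by exact: fA.
near=> x; have : t0 <= x <= t1 -> A (f x).
  by near: x; apply: cvg_at_left_filter (fun _ => id) _ _.
apply; apply/andP; split; near: x; [exact: nbhs_left_ge|exact: nbhs_left_le].
Unshelve. all: by end_near. Qed.

Lemma PC_cvg_right (R : realType) (t0 t1 : R) (f : R -> R) : t0 < t1 -> PC t0 t1 f ->
  f x @[x --> t0^'+] --> f t0.
Proof.
move=> t01 [s [sin [sC _]]].
have [|//|_ cf] := sC t0 _ _; first by rewrite lexx ltW.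
  by apply/negP => /sin; rewrite ltxx.
move=> A /cf fA; change (\forall x \near t0^'+, A (f x)).
have {}fA : \forall y \near t0, t0 <= y <= t1 -> A (f y) by exact: fA.
near=> x; have : t0 <= x <= t1 -> A (f x).
  by near: x; apply: cvg_at_right_filter (fun _ => id) _ _.
apply; apply/andP; split; near: x; [exact: nbhs_right_ge|exact: nbhs_right_le].
Unshelve. all: by end_near. Qed.

(** * Composition of fractional integrals and the Caputo derivative *)

Lemma integrable_powRB1_reflect (R : realType) (a c d t : R) : 0 < a -> d <= t ->
  (@lebesgue_measure R).-integrable `[c, d] (fun u : R => ((t - u) `^ (a - 1))%:E).
Proof.
move=> a0 dt; apply/integrableP; split.
  by apply/measurable_EFinP; exact: measurable_powR_subr.
under eq_integral do rewrite gee0_abs ?lee_fin ?powR_ge0//.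
have [cd|dc] := leP c d; first by rewrite integral_powRB1_reflect// ltry.
by rewrite set_itv_ge ?integral_set0// bnd_simp -ltNge.
Qed.

Lemma integrable_powRB1_reflectM (R : realType) (a c d t M : R) (psi : R -> R) :
  0 < a -> d <= t -> measurable_fun `[c, d] psi ->
  (forall u, c <= u <= d -> `|psi u| <= M) ->
  (@lebesgue_measure R).-integrable `[c, d]
    (EFin \o (fun u : R => (t - u) `^ (a - 1) * psi u)).
Proof.
move=> a0 dt mpsi psiM.
apply: (@le_integrable _ _ R (@lebesgue_measure R) `[c,d]%classic
  (measurable_itv _) _ (fun u => M%:E * ((t - u) `^ (a - 1))%:E)%E).
- apply/measurable_EFinP; apply: measurable_funM => //.
  exact: measurable_powR_subr.
- move=> u; rewrite /= in_itv/= => cud; rewrite lee_fin !normrM.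
  rewrite mulrC ler_wpM2r//.
  by rewrite (le_trans (psiM u cud))// ler_norm.
- by apply: integrableZl => //; exact: integrable_powRB1_reflect.
Qed.

Section riemann_liouville_composition.
Context {R : realType}.
Variables (a t0 t M : R) (psi : R -> R).
Hypotheses (a0 : 0 < a) (a1 : a < 1).
Hypothesis mpsi : measurable_fun `[t0, t] psi.
Hypothesis psiM : forall u, t0 <= u <= t -> `|psi u| <= M.
Let mu : {measure set (measurableTypeR R) -> \bar R} := @lebesgue_measure R.
Let A : set (measurableTypeR R * measurableTypeR R) :=
  [set z | z.2 <= z.1 /\ z.1 <= t].
(** Here z = (u, s), with s the variable of psi. The indicator is indispensable: outside the
    triangle a power has a negative base, and its value is 1 instead of 0. *)
Let N (z : measurableTypeR R * measurableTypeR R) : R :=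
  \1_A z * ((t - z.1) `^ (1 - a - 1) * (z.1 - z.2) `^ (a - 1)).
(* Half-open, so that K vanishes at z.2 = t, where the integral of N is 0. *)
Let p : R -> R := psi \_ `[t0, t[.
Let K (z : measurableTypeR R * measurableTypeR R) : R := N z * p z.2.

Let measurable_A : measurable A.
Proof.
have -> : A = ((fun z : measurableTypeR R * measurableTypeR R => z.2 <= z.1) @^-1` [set true]) `&`
  ((fun z : measurableTypeR R * measurableTypeR R => z.1 <= t) @^-1` [set true]).
  by apply/seteqP; split.
apply: measurableI.
  rewrite -[X in measurable X]setTI.
  by apply: (measurable_fun_ler measurable_snd measurable_fst).
rewrite -[X in measurable X]setTI.
by apply: (measurable_fun_ler measurable_fst (measurable_cst t)).
Qed.

Let measurable_N : measurable_fun setT N.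
Proof.
apply: measurable_funM; first exact: measurable_indic.
apply: measurable_funM.
  apply: (@measurableT_comp _ _ _ _ _ _ (@powR R ^~ _) _
    (fun z : measurableTypeR R * measurableTypeR R => t - z.1)).
    exact: measurable_powR.
  by apply: measurable_funB.
apply: (@measurableT_comp _ _ _ _ _ _ (@powR R ^~ _) _
  (fun z : measurableTypeR R * measurableTypeR R => z.1 - z.2)).
  exact: measurable_powR.
by apply: measurable_funB.
Qed.

Let measurable_p : measurable_fun setT p.
Proof.
apply/(measurable_restrictT _ _).1; first exact: measurable_itv.
apply: measurable_funS mpsi => //; exact: subset_itv_co_cc.
Qed.

Let measurable_K : measurable_fun setT K.
Proof.
by apply: measurable_funM => //; exact: (measurableT_comp measurable_p).
Qed.

Let N_ge0 z : 0 <= N z.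
Proof. by rewrite !mulr_ge0 ?powR_ge0. Qed.

Let B := beta_integral a (1 - a).

Let integral_N s : s < t -> (\int[mu]_u (N (u, s))%:E = B)%E.
Proof.
move=> st; rewrite /B -(integral_beta_kernel st); last by rewrite subrKC.
rewrite [RHS]integral_mkcond; apply: eq_integral => u _.
rewrite patchE mem_setE in_itv/= /N indicE /=.
case: ifPn => h; first by rewrite mem_set ?mul1r//; exact/andP.
by rewrite memNset ?mul0r// => /andP; rewrite (negPf h).
Qed.

Let B_fin : B = (fine B)%:E.
Proof.
have b1 : 1 - a <= 1 by rewrite gerBl ltW.
have b0 : 0 < 1 - a by rewrite subr_gt0.
rewrite fineK// fin_num_abs gee0_abs.
  by apply: beta_integral_lty; rewrite ?a0 ?b0 ?(ltW a1).
by apply: (@le_trans _ _ 1%E) => //; exact: beta_integral_ge1 (ltW a1) b1.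
Qed.

Let integrable_N s : s < t -> mu.-integrable setT (fun u => (N (u, s))%:E).
Proof.
move=> st; apply/integrableP; split.
  apply/measurable_EFinP.
  exact: (measurableT_comp measurable_N (measurable_pair2 s)).
under eq_integral do rewrite gee0_abs ?lee_fin ?N_ge0//.
by rewrite integral_N// B_fin ltry.
Qed.

(** Stated for a general q because it serves twice: with [|p|] for integrability and with [p] for
    the value of the double integral. *)
Let integral_NM (q : R -> R) s : (t <= s -> q s = 0) ->
  (\int[mu]_u (N (u, s) * q s)%:E = (q s * fine B)%:E)%E.
Proof.
move=> qs; have [ts|st] := leP t s.
  by rewrite (qs ts) mul0r; under eq_integral do rewrite mulr0; rewrite integral0.
under eq_integral do rewrite EFinM.
by rewrite integralZr// ?integral_N// 1?B_fin 1?muleC//; exact: integrable_N.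
Qed.

Let p_ge s : t <= s -> p s = 0.
Proof. by move=> ts; rewrite /p patchE memNset//= in_itv/= ltNge ts andbF. Qed.

Let integrable_psi : mu.-integrable `[t0, t] (EFin \o psi).
Proof.
have := @integrable_powRB1_reflectM R 1 t0 t t M psi ltr01 (lexx t) mpsi psiM.
rewrite (_ : (fun _ => _ * _) = psi)//.
by apply/funext => u; rewrite subrr powRr0 mul1r.
Qed.

Let integrable_p : mu.-integrable setT (EFin \o p).
Proof.
rewrite /p -restrict_EFin -integrable_mkcond//.
by apply: integrableS integrable_psi => //; exact: subset_itv_co_cc.
Qed.

(** By Tonelli: integrating [|K|] in u first leaves [|p s| * fine B], which is integrable because
    [p] is. *)
Let integrable_K : (mu \x mu)%E.-integrable setT (EFin \o K).
Proof.
apply/integrable21ltyP; first exact/measurable_EFinP.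
rewrite (_ : (fun y => _) = (fun s => (`|p s| * fine B)%:E)); last first.
  apply/funext => s; rewrite -(integral_NM (q := fun s => `|p s|)).
    by apply: eq_integral => u _; rewrite /= normrM (ger0_norm (N_ge0 _)).
  by move=> /p_ge ->; rewrite normr0.
have ip : mu.-integrable setT (fun s => `|p s|%:E) by exact: integrable_abse integrable_p.
under eq_integral do rewrite EFinM.
by rewrite integralZr// -(fineK (integrable_fin_num _ ip))// -EFinM ltry.
Qed.

Let J (u : R) : R := \int[mu]_(s in `[t0, u]) ((u - s) `^ (a - 1) * psi s).

(** For u < t the constraint s <= u already forces s < t, so the half-open support of [p] loses
    nothing. For u outside [[t0, t]], the indicator and [p] cannot both be nonzero. *)
Let integral_K u : (\int[mu]_s (K (u, s))%:E =
  ((fun u => (t - u) `^ (1 - a - 1) * J u) \_ `[t0, t] u)%:E)%E.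
Proof.
rewrite patchE mem_setE in_itv/=; case: ifPn => [/andP[t0u ut]|u_out]; last first.
  rewrite integral0_eq// => s _; rewrite /K /N /p/= patchE indicE.
  have [su|us] := leP s u; last first.
    by rewrite memNset ?mul0r//= => -[]; rewrite leNgt us.
  have [ut|tu] := leP u t; last first.
    by rewrite memNset ?mul0r//= => -[_]; rewrite leNgt tu.
  rewrite [in X in _ * X]memNset ?mulr0//= in_itv/= => /andP[t0s _].
  by move/negP: u_out; apply; rewrite ut andbT (le_trans t0s).
move: ut; rewrite le_eqVlt => /predU1P[->|ut].
  have na : 1 - a - 1 != 0 by rewrite addrAC subrr add0r oppr_eq0 gt_eqF.
  (* junk value: the weight 0 `^ (- a) is 0 at u = t *)
  rewrite subrr powR0// mul0r integral0_eq// => s _.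
  by rewrite /K /N/= subrr powR0// !(mul0r, mulr0).
have iJ := @integrable_powRB1_reflectM R a t0 u u M psi a0 (lexx u).
have {}iJ : mu.-integrable `[t0, u] (EFin \o (fun s => (u - s) `^ (a - 1) * psi s)).
  apply: iJ.
    by apply: measurable_funS mpsi => // s /=; rewrite !in_itv/= => /andP[->];
      move=> /le_trans->//; exact: ltW.
  by move=> s /andP[t0s su]; rewrite psiM// t0s (le_trans su)// ltW.
rewrite EFinM /J /Rintegral fineK; last exact: integrable_fin_num.
rewrite -integralZl// [RHS]integral_mkcond; apply: eq_integral => s _.
rewrite patchE mem_setE in_itv/= /K /N /p/= patchE mem_setE in_itv/= indicE.
have [t0s|//] := leP t0 s; rewrite ?mulr0//=.
have [su|us] := leP s u; last first.
  by rewrite memNset ?mul0r//= => -[]; rewrite leNgt us.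
rewrite (le_lt_trans su ut) mem_set; last by split => //; exact: ltW.
by rewrite mul1r -EFinM mulrA.
Qed.

(** Up to Gamma factors, the semigroup law for I^(1-a) I^a. The exponent [1 - a - 1] is left
    unsimplified to match [RL_integral (1 - a)]. *)
Lemma Rintegral_powRB1_comp :
  \int[mu]_(u in `[t0, t]) ((t - u) `^ (1 - a - 1) *
    \int[mu]_(s in `[t0, u]) ((u - s) `^ (a - 1) * psi s)) =
  fine (beta_integral a (1 - a)) * \int[mu]_(s in `[t0, t]) psi s.
Proof.
have ipo : mu.-integrable `[t0, t[ (EFin \o psi).
  by apply: integrableS integrable_psi => //; exact: subset_itv_co_cc.
rewrite -[X in _ = _ * X](Rintegral_itv_bndo_bndc ipo).
have := Fubini integrable_K.
under eq_integral do rewrite integral_K.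
under [X in _ = X -> _]eq_integral => s _ do rewrite (integral_NM (@p_ge s)).
rewrite -/B Rintegral_mkcond => /(congr1 fine); rewrite -/(Rintegral _ _ _) => ->.
rewrite -/(Rintegral _ _ _) [in RHS]Rintegral_mkcond RintegralZr//.
by rewrite mulrC.
Qed.
End riemann_liouville_composition.

(* In fact 1, as B(a, 1 - a) = Gamma(a) Gamma(1 - a), but only its being nonzero
   matters. *)
Definition caputo_RL_const (R : realType) (a : R) : R :=
  if a < 1 then (Gamma (1 - a))^-1 * fine (beta_integral a (1 - a)) * (Gamma a)^-1
  else (Gamma a)^-1.

Lemma caputo_RL_const_neq0 (R : realType) (a : R) : 0 < a -> a <= 1 ->
  caputo_RL_const a != 0.
Proof.
move=> a0 a1; rewrite /caputo_RL_const.
have Ga : (Gamma a)^-1 != 0 by rewrite invr_eq0 gt_eqF// Gamma_gt0.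
case: ifPn => // a_lt1.
have b0 : 0 < 1 - a by rewrite subr_gt0.
have b1 : 1 - a <= 1 by rewrite gerBl ltW.
rewrite !mulf_neq0// ?invr_eq0 ?gt_eqF// ?Gamma_gt0//.
rewrite fine_gt0// beta_integral_lty ?a0 ?b0//= andbT.
by apply: (@lt_le_trans _ _ 1%E) => //; exact: beta_integral_ge1.
Qed.

Lemma PC_integrable (R : realType) (t0 t1 : R) (f : R -> R) :
  PC t0 t1 f -> (@lebesgue_measure R).-integrable `[t0, t1] (EFin \o f).
Proof.
move=> PCf; have [M fM] := PC_bounded PCf.
have := @integrable_powRB1_reflectM R 1 t0 t1 t1 M f ltr01 (lexx t1) (PC_measurable PCf) fM.
rewrite (_ : (fun _ => _ * _) = f)//.
by apply/funext => u; rewrite subrr powRr0 mul1r.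
Qed.

Lemma caputo_RL (R : realType) (a t0 t1 t : R) (psi phi : R -> R) :
  0 < a -> a <= 1 -> PC t0 t1 psi ->
  (forall x, t0 <= x <= t1 -> phi x = phi t0 + RL_integral a t0 psi x) ->
  t0 < t < t1 -> continuity_points t0 t1 psi t ->
  caputo a t0 phi t = caputo_RL_const a * psi t.
Proof.
move=> a0 a1 PCpsi phiE t01 /(continuity_points_continuous t01) cpsi.
have [M psiM] := PC_bounded PCpsi; have mpsi := PC_measurable PCpsi.
have /andP[t0t tt1] := t01.
have [dF F'] := continuous_FTC1_closed tt1 (PC_integrable PCpsi) t0t cpsi.
set F := (fun x : R => _) in dF F'.
have near_t : \forall x \near t, t0 < x < t1.
  by apply: filterS2 (lt_nbhsr t0t) (lt_nbhsl tt1) => x ? ?; exact/andP.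
(* Both branches of [caputo] differentiate a function equal to [c + F x * k] near t, with c = 0 if a
   < 1 and c = [phi t0] if a = 1. *)
have Fk (k c : R) (g : R -> R) : (forall x, t0 < x < t1 -> g x = c + F x * k) ->
    derive1 g t = k * psi t.
  move=> gE; rewrite derive1E (@near_eq_derive _ _ _ _ (cst c \+ (fun x => F x * k)));
    last first.
    by apply: filterS near_t => x /gE.
  rewrite deriveD//; last by apply: derivableM.
  by rewrite derive_cst add0r deriveMr// -derive1E F'.
rewrite /caputo /caputo_RL_const; case: ifPn => [a_lt1|a_ge1].
  apply: (Fk _ 0) => x /andP[t0x xt1]; rewrite add0r /RL_integral.
  (* The Gamma factor of the inner integral is absorbed into psi, so that the composition formula
     applies verbatim. *)
  pose psi' s := (Gamma a)^-1 * psi s.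
  have xsub : `[t0, x] `<=` `[t0, t1].
    by move=> s /=; rewrite !in_itv/= => /andP[->];
      move=> /le_trans->//; exact: ltW.
  have mpsi' : measurable_fun `[t0, x] psi'.
    by apply: measurable_funM => //; exact: measurable_funS mpsi.
  have psi'M u : t0 <= u <= x -> `|psi' u| <= `|(Gamma a)^-1| * M.
    move=> /andP[t0u ux]; rewrite normrM ler_wpM2l// psiM// t0u (le_trans ux)//.
    exact: ltW.
  have := Rintegral_powRB1_comp a0 a_lt1 mpsi' psi'M.
  rewrite RintegralZl//; last first.
    by apply: integrableS (PC_integrable PCpsi).
  rewrite -/(F x) => FE.
  transitivity ((Gamma (1 - a))^-1 * (fine (beta_integral a (1 - a)) *
    ((Gamma a)^-1 * F x))); last by ring.
  rewrite -FE; congr (_ * _); apply: eq_Rintegral => u.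
  rewrite mem_setE in_itv/= => /andP[t0u ux].
  congr (_ * _); rewrite phiE ?t0u ?(le_trans ux (ltW xt1))//.
  rewrite addrC addKr /RL_integral -RintegralZl//.
    by apply: eq_Rintegral => s _; rewrite /psi' mulrCA.
  apply: (@integrable_powRB1_reflectM _ _ _ _ _ M) => //.
    apply: measurable_funS mpsi => // s /=; rewrite !in_itv/= => /andP[-> su].
    by rewrite (le_trans su)// (le_trans ux)// ltW.
  by move=> s /andP[t0s su]; rewrite psiM// t0s (le_trans su)// (le_trans ux)// ltW.
have aE : a = 1 by apply/eqP; rewrite eq_le a1 leNgt.
apply: (Fk _ (phi t0)) => x /andP[t0x xt1].
rewrite phiE ?(ltW t0x) ?(ltW xt1)// /RL_integral mulrC; congr (_ + _ * _).
by apply: eq_Rintegral => s _; rewrite aE subrr powRr0 mul1r.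
Qed.

(** * Test functions with one jump *)

Definition step_test (R : realType) (x lam u : R) : R := (u <= x)%R%:R - lam.

(** The minimum covers both positions of t relative to x: t = t1 gives the orthogonality relations,
    a general t gives the fractional integral of the test function. *)
Lemma Rintegral_mul_step_test (R : realType) (t0 t x lam : R) (w : R -> R) :
  (@lebesgue_measure R).-integrable `[t0, t] (EFin \o w) ->
  \int[@lebesgue_measure R]_(u in `[t0, t]) (w u * step_test x lam u) =
  \int[@lebesgue_measure R]_(u in `[t0, Num.min x t]) w u -
  lam * \int[@lebesgue_measure R]_(u in `[t0, t]) w u.
Proof.
move=> iw; pose P : set R := `]-oo, x]%classic.
have iwP : (@lebesgue_measure R).-integrable `[t0, t] (EFin \o (w \_ P)).
  rewrite -restrict_EFin; apply/integrable_restrict => //.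
    exact: measurable_itv.
  apply: (@integrableS _ _ R (@lebesgue_measure R) `[t0, t]%classic) iw => //.
    by apply: measurableI => //; exact: measurable_itv.
have ilw : (@lebesgue_measure R).-integrable `[t0, t] (EFin \o (fun u => lam * w u)).
  by apply: (@integrableZl _ _ R (@lebesgue_measure R) `[t0, t]%classic _ lam (EFin \o w)).
rewrite -RintegralZl// (_ : `[t0, Num.min x t]%classic = `[t0, t] `&` P); last first.
  apply/seteqP; split => u; rewrite /P/= !in_itv/= le_min.
    by move=> /and3P[-> -> ->].
  by move=> [/andP[-> ->] ->].
rewrite Rintegral_mkcondr -RintegralB//; apply: eq_Rintegral => u _.
rewrite patchE mem_setE in_itv/= /step_test mulrBr [w u * lam]mulrC.
by case: ifP => _; rewrite ?mulr1 ?mulr0.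
Qed.

Lemma PC_step_test (R : realType) (t0 t1 x lam : R) : t0 < x < t1 ->
  PC t0 t1 (step_test x lam).
Proof.
move=> xt.
have nl (t : R) : t < x -> \forall y \near t, step_test x lam y = 1 - lam.
  by move=> tx; apply: filterS (lt_nbhsl tx) => y /ltW yx; rewrite /step_test yx.
have nr (t : R) : x < t -> \forall y \near t, step_test x lam y = - lam.
  by move=> xt'; apply: filterS (lt_nbhsr xt') => y xy; rewrite /step_test leNgt xy sub0r.
exists [:: x]; split; [|split].
- by move=> t; rewrite inE => /eqP ->.
- move=> t tt; rewrite inE => tx; split => //.
  apply: (@cvg_within_filter _ _ _ (nbhs t)).
  have [h|h|h] := ltgtP t x; last by rewrite h eqxx in tx.
  + rewrite (nbhs_singleton (nl _ h)); apply: cvg_near_cst; exact: nl.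
  + rewrite (nbhs_singleton (nr _ h)); apply: cvg_near_cst; exact: nr.
- move=> t; rewrite inE => /eqP ->; split; apply/cvg_ex.
  + exists (1 - lam); apply: cvg_near_cst; near=> y; rewrite /step_test ltW//.
  + exists (- lam); apply: cvg_near_cst; near=> y; rewrite /step_test leNgt.
    by rewrite (_ : x < y) ?sub0r//; near: y; exact: nbhs_right_gt.
Unshelve. all: by end_near. Qed.

(** This closed form reduces continuity of the fractional integral to continuity of powers of
    positive parts. *)
Lemma RL_integral_step_test (R : realType) (a t0 t1 x lam t : R) :
  0 < a -> t0 < x < t1 -> t0 <= t ->
  RL_integral a t0 (step_test x lam) t =
  (Gamma a)^-1 * (((t - t0) `^ a - (Num.max (t - x) 0) `^ a) / a -
    lam * ((t - t0) `^ a / a)).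
Proof.
move=> a0 /andP[t0x _] t0t.
have iw := @integrable_powRB1_reflect R a t0 t t a0 (lexx t).
rewrite /RL_integral Rintegral_mul_step_test//; congr (_ * (_ - _ * _)).
  rewrite /Rintegral integral_powRB1_reflect//=; last 2 first.
  - by rewrite le_min t0t ltW.
  - by rewrite ge_min lexx orbT.
  congr ((_ - _ `^ a) / a); have [?|?] := leP x t.
    by rewrite max_l// subr_ge0.
  by rewrite subrr max_r// subr_le0 ltW.
by rewrite /Rintegral integral_powRB1_reflect//= subrr powR0 ?gt_eqF// subr0.
Qed.

(** The choice of [lam] is the one that makes the fractional integral vanish at t1. *)
Lemma PCalpha0_step_test (R : realType) (a t0 t1 x : R) :
  0 < a -> t0 < x < t1 ->
  let lam := (\int[@lebesgue_measure R]_(u in `[t0, x]) (t1 - u) `^ (a - 1)) /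
             (\int[@lebesgue_measure R]_(u in `[t0, t1]) (t1 - u) `^ (a - 1)) in
  PCalpha0 a t0 t1 (RL_integral a t0 (step_test x lam)).
Proof.
move=> a0 xt lam; have /andP[t0x xt1] := xt; have t01 := lt_trans t0x xt1.
have h0 : RL_integral a t0 (step_test x lam) t0 = 0.
  rewrite (RL_integral_step_test _ a0 xt)// subrr powR0 ?gt_eqF//.
  by rewrite max_r ?powR0 ?gt_eqF ?subr_le0 ?(ltW t0x)// subrr !mul0r mulr0 subrr mulr0.
have W1 : \int[@lebesgue_measure R]_(u in `[t0, t1]) (t1 - u) `^ (a - 1) != 0.
  rewrite /Rintegral integral_powRB1_reflect//=; last exact: ltW.
  by rewrite subrr powR0 ?gt_eqF// subr0 divr_gt0// powR_gt0// subr_gt0.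
split => //; last first.
  rewrite /RL_integral Rintegral_mul_step_test; last exact: integrable_powRB1_reflect.
  by rewrite min_l ?(ltW xt1)// /lam divfK// subrr mulr0.
split; last first.
  by exists (step_test x lam); [exact: PC_step_test|move=> t _; rewrite h0 add0r].
(* A continuous extension to the whole line: the positive part of t - t0 avoids the default value of
   powers to the left of t0. *)
pose g (t : R) := (Gamma a)^-1 *
  (((Num.max (t - t0) 0) `^ a - (Num.max (t - x) 0) `^ a) / a -
    lam * ((Num.max (t - t0) 0) `^ a / a)).
have cg : continuous g.
  have cm c : continuous (fun t : R => (Num.max (t - c) 0) `^ a).
    move=> t; apply: (@continuous_comp _ _ _ (fun t => t - c) (fun t => (Num.max t 0) `^ a)).
      by apply: cvgB; [exact: cvg_id|exact: cvg_cst].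
    exact: continuous_powR_max0.
  move=> t; apply: cvgM; first exact: cvg_cst.
  apply: cvgB; first by apply: cvgM; [apply: cvgB; exact: cm|exact: cvg_cst].
  by apply: cvgM; [exact: cvg_cst|apply: cvgM; [exact: cm|exact: cvg_cst]].
apply: (@subspace_eq_continuous _ _ _ g); last exact: continuous_subspaceT.
move=> t; rewrite mem_setE in_itv/= => /andP[t0t _].
by rewrite /from_subspace (RL_integral_step_test _ a0 xt)// /g (@max_l _ _ (t - t0)) ?subr_ge0.
Qed.

(** * Orthogonality and proportionality *)

Lemma itv_oo_of_cc (R : realType) (t0 t1 t : R) :
  t0 <= t -> t <= t1 -> t != t0 -> t != t1 -> t0 < t < t1.
Proof. by rewrite !le_eqVlt => /predU1P[->|->] /predU1P[->|->]; rewrite ?eqxx. Qed.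

Section weighted_orthogonality.
Context {R : realType}.
Variables (t0 t1 alpha beta : R) (f : R -> R).
Hypotheses (t01 : t0 < t1) (PCf : PC t0 t1 f).
Hypotheses (alpha0 : 0 < alpha) (alpha1 : alpha <= 1) (beta0 : 0 < beta).
Let mu := @lebesgue_measure R.

Lemma integrable_weight_mul (psi : R -> R) : PC t0 t1 psi ->
  (@lebesgue_measure R).-integrable `[t0, t1]
    (EFin \o (fun t => (t1 - t) `^ (beta - 1) * f t * psi t)).
Proof.
move=> PCpsi; have [M fM] := PC_bounded PCf; have [N psiN] := PC_bounded PCpsi.
rewrite (_ : (fun _ => _) = (fun t => (t1 - t) `^ (beta - 1) * (f t * psi t))); last first.
  by apply/funext => t; rewrite mulrA.
apply: (@integrable_powRB1_reflectM _ _ _ _ _ (M * N)) => //.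
  by apply: measurable_funM; exact: PC_measurable.
by move=> u ut; rewrite normrM ler_pM// ?fM ?psiN.
Qed.

Lemma Rintegral_weight_caputo (psi h : R -> R) : PC t0 t1 psi ->
  (forall t, t0 <= t <= t1 -> h t = h t0 + RL_integral alpha t0 psi t) ->
  \int[mu]_(t in `[t0, t1]) ((t1 - t) `^ (beta - 1) * f t * caputo alpha t0 h t) =
  caputo_RL_const alpha * \int[mu]_(t in `[t0, t1]) ((t1 - t) `^ (beta - 1) * f t * psi t).
Proof.
move=> PCpsi hE; have iw := integrable_weight_mul PCpsi.
rewrite -RintegralZl//; have [s [sin [sC _]]] := PCpsi.
(* The endpoints join the jumps as exceptional points because [caputo] is a two-sided derivative. *)
apply: (@Rintegral_eq_setD_seq _ _ [:: t0, t1 & s]) => //.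
  apply: measurable_funM => //; apply/measurable_EFinP; exact: measurable_int iw.
move=> t; rewrite /= in_itv/= => /andP[t0t tt1].
rewrite !inE !negb_or => /and3P[tt0 tt1' ts].
have tlt := itv_oo_of_cc t0t tt1 tt0 tt1'.
have Ct : continuity_points t0 t1 psi t by apply: sC => //; rewrite t0t.
by rewrite (caputo_RL alpha0 alpha1 PCpsi hE tlt Ct) mulrCA.
Qed.

(** This is g = c w divided by the weight of g. It is confined to the open interval: for alpha <
    beta the power at t1 would be the default value 0. *)
Let proportional (c : R) := forall t, t0 < t < t1 -> continuity_points t0 t1 f t ->
  f t = c * (t1 - t) `^ (alpha - beta).

Lemma proportional_orthogonal (c : R) : proportional c ->
  forall h : R -> R, PCalpha0 alpha t0 t1 h ->
  \int[mu]_(t in `[t0, t1]) ((t1 - t) `^ (beta - 1) * f t * caputo alpha t0 h t) = 0.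
Proof.
move=> fc h [[_ [psi PCpsi hE]] h0 h1].
rewrite (Rintegral_weight_caputo PCpsi hE).
have [N psiN] := PC_bounded PCpsi.
have iw : (@lebesgue_measure R).-integrable `[t0, t1]
    (EFin \o (fun t => (t1 - t) `^ (alpha - 1) * psi t)).
  by apply: (@integrable_powRB1_reflectM _ _ _ _ _ N) => //; exact: PC_measurable.
suff -> : \int[mu]_(t in `[t0, t1]) ((t1 - t) `^ (beta - 1) * f t * psi t) =
    c * \int[mu]_(t in `[t0, t1]) ((t1 - t) `^ (alpha - 1) * psi t).
  (* Evaluating the representation of h at t1 turns h(t1) = 0 into the vanishing of \int w psi. *)
  have := hE t1; rewrite h0 h1 add0r lexx (ltW t01) => /(_ isT) /esym /eqP.
  rewrite mulf_eq0 invr_eq0 gt_eqF ?Gamma_gt0//= => /eqP ->.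
  by rewrite !mulr0.
rewrite -RintegralZl//; have [s [sin [sC _]]] := PCf.
apply: (@Rintegral_eq_setD_seq _ _ [:: t0, t1 & s]) => //.
  apply: measurable_funM => //; apply/measurable_EFinP; exact: measurable_int iw.
move=> t; rewrite /= in_itv/= => /andP[t0t tt1].
rewrite !inE !negb_or => /and3P[tt0 tt1' ts].
have tlt := itv_oo_of_cc t0t tt1 tt0 tt1'.
rewrite fc//; last by apply: sC => //; rewrite t0t.
have -> : (t1 - t) `^ (alpha - 1) = (t1 - t) `^ (beta - 1) * (t1 - t) `^ (alpha - beta).
  have ne : t1 - t != 0 by rewrite subr_eq0 gt_eqF//; case/andP: tlt.
  by rewrite -powRD ?ne ?implybT//; congr powR; ring.
by ring.
Qed.

Lemma orthogonal_proportional :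
  (forall h : R -> R, PCalpha0 alpha t0 t1 h ->
   \int[mu]_(t in `[t0, t1]) ((t1 - t) `^ (beta - 1) * f t * caputo alpha t0 h t) = 0) ->
  exists c, proportional c.
Proof.
move=> orth.
pose G x := \int[mu]_(t in `[t0, x]) ((t1 - t) `^ (beta - 1) * f t).
pose W x := \int[mu]_(t in `[t0, x]) ((t1 - t) `^ (alpha - 1)).
have [M fM] := PC_bounded PCf; have mf := PC_measurable PCf.
have ig : (@lebesgue_measure R).-integrable `[t0, t1]
    (EFin \o (fun t => (t1 - t) `^ (beta - 1) * f t)).
  exact: (@integrable_powRB1_reflectM _ _ _ _ _ M).
have iw := @integrable_powRB1_reflect R alpha t0 t1 t1 alpha0 (lexx t1).
(* Orthogonality to the test function reads C * (G x - (W x / W t1) * G t1) = 0 with C nonzero,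
   which dictates this ratio. *)
pose c := G t1 / W t1.
have GW x : t0 < x < t1 -> G x = W x * c.
  move=> xt; have /andP[t0x xt1] := xt.
  have PCh := PCalpha0_step_test alpha0 xt.
  have := orth _ PCh; move: PCh => [_ h0 _].
  rewrite (Rintegral_weight_caputo (PC_step_test (W x / W t1) xt)); last first.
    by move=> t _; rewrite h0 add0r.
  rewrite Rintegral_mul_step_test// min_l ?(ltW xt1)//.
  move=> /eqP; rewrite mulf_eq0 (negPf (caputo_RL_const_neq0 alpha0 alpha1))/= subr_eq0.
  by move=> /eqP GE; rewrite /G GE -/(G t1) -/(W x) -/(W t1) /c mulrAC mulrA.
exists c => x xt Tx; have /andP[t0x xt1] := xt.
have x1 : 0 < t1 - x by rewrite subr_gt0.
have cpow (d : R) : {for x, continuous (fun t : R => (t1 - t) `^ d)}.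
  apply: (@continuous_comp _ _ _ (fun t => t1 - t) (fun t => t `^ d)).
    by apply: cvgB; [exact: cvg_cst|exact: cvg_id].
  apply: differentiable_continuous; apply/derivable1_diffP.
  by apply: derivable_powR; rewrite in_itv/= andbT.
have cf := continuity_points_continuous xt Tx.
have [_ G'] := continuous_FTC1_closed xt1 ig t0x (cvgM (cpow _) cf).
have [dW W'] := continuous_FTC1_closed xt1 iw t0x (cpow _).
have : derive1 G x = (t1 - x) `^ (alpha - 1) * c.
  rewrite derive1E (@near_eq_derive _ _ _ _ (fun x => W x * c)).
    by rewrite deriveMr// -derive1E W' /= mulrC.
  by apply: filterS2 (lt_nbhsr t0x) (lt_nbhsl xt1) => y ? ?; apply: GW; exact/andP.
rewrite G' /= => E.
have nz : (t1 - x) `^ (beta - 1) != 0 by rewrite gt_eqF// powR_gt0.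
apply: (mulfI nz); rewrite E [LHS]mulrC [RHS]mulrCA; congr (_ * _).
by rewrite -powRD ?(gt_eqF x1) ?implybT//; congr powR; ring.
Qed.
End weighted_orthogonality.

(** * Passage to the endpoints *)

Lemma PC_eq_left (R : realType) (t0 t1 l : R) (f g : R -> R) : t0 < t1 -> PC t0 t1 f ->
  (forall t, t0 < t < t1 -> continuity_points t0 t1 f t -> f t = g t) ->
  g t @[t --> t1^'-] --> l -> f t1 = l.
Proof.
move=> t01 PCf fg gl; apply: (@cvg_unique _ (@Rhausdorff R) (f t @[t --> t1^'-])).
  exact: PC_cvg_left PCf.
apply: cvg_trans gl; apply: near_eq_cvg.
by apply: filterS (PC_near_left t01 PCf) => t [Tt tt]; rewrite fg.
Qed.

Lemma PC_eq_right (R : realType) (t0 t1 l : R) (f g : R -> R) : t0 < t1 -> PC t0 t1 f ->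
  (forall t, t0 < t < t1 -> continuity_points t0 t1 f t -> f t = g t) ->
  g t @[t --> t0^'+] --> l -> f t0 = l.
Proof.
move=> t01 PCf fg gl; apply: (@cvg_unique _ (@Rhausdorff R) (f t @[t --> t0^'+])).
  exact: PC_cvg_right PCf.
apply: cvg_trans gl; apply: near_eq_cvg.
by apply: filterS (PC_near_right t01 PCf) => t [Tt tt]; rewrite fg.
Qed.

Lemma powR_subr_cvg_left (R : realType) (t1 d : R) : 0 <= d ->
  (t1 - t) `^ d @[t --> t1^'-] --> (t1 - t1) `^ d.
Proof.
rewrite le_eqVlt => /predU1P[<-|d0].
  by rewrite powRr0; under eq_fun do rewrite powRr0; exact: cvg_cst.
have c : {for t1, continuous (fun t : R => Num.max (t1 - t) 0 `^ d)}.
  apply: (@continuous_comp _ _ _ (fun t => t1 - t) (fun t => (Num.max t 0) `^ d)).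
    by apply: cvgB; [exact: cvg_cst|exact: cvg_id].
  exact: continuous_powR_max0.
have := cvg_at_left_filter c; rewrite subrr maxxx.
apply: cvg_trans; apply: near_eq_cvg; near=> t; rewrite max_l// subr_ge0.
by near: t; exact: nbhs_left_le.
Unshelve. all: by end_near. Qed.

Lemma proportional_closed (R : realType) (t0 t1 c d : R) (f : R -> R) :
  t0 < t1 -> PC t0 t1 f -> 0 <= d ->
  (forall t, t0 < t < t1 -> continuity_points t0 t1 f t -> f t = c * (t1 - t) `^ d) ->
  forall t, continuity_points t0 t1 f t -> f t = c * (t1 - t) `^ d.
Proof.
move=> t01 PCf d0 fc t Tt; have [/andP[]] := Tt.
rewrite le_eqVlt => /predU1P[<- _ _|t0t].
  apply: (PC_eq_right t01 PCf fc); apply: cvgM; first exact: cvg_cst.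
  apply: cvg_at_right_filter.
  apply: (@continuous_comp _ _ _ (fun t => t1 - t) (fun t => t `^ d)).
    by apply: cvgB; [exact: cvg_cst|exact: cvg_id].
  apply: differentiable_continuous; apply/derivable1_diffP.
  by apply: derivable_powR; rewrite in_itv/= andbT subr_gt0.
rewrite le_eqVlt => /predU1P[-> _|tt1 _]; last by apply: fc => //; exact/andP.
apply: (PC_eq_left t01 PCf fc); apply: cvgM; first exact: cvg_cst.
exact: powR_subr_cvg_left.
Qed.

Unset Implicit Arguments.

(* Real powers use the convention 0 `^ 0 = 1.
   In case 2, the function f vanishing on its continuity points satisfies the
   integral identity but is not of the form with k != 0, so it is listed as a
   separate alternative. *)
Theorem lemma1 (R : realType) (t0 t1 alpha beta : R) (f : R -> R) :
  t0 < t1 -> PC t0 t1 f -> 0 < alpha -> alpha <= 1 -> 0 < beta ->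
  (forall h : R -> R, PCalpha0 alpha t0 t1 h ->
     \int[@lebesgue_measure R]_(t in `[t0, t1])
       ((t1 - t) `^ (beta - 1) * f t * caputo alpha t0 h t) = 0)
  <->
  ((alpha < beta ->
      forall t, continuity_points t0 t1 f t -> (t1 - t) `^ (beta - alpha) * f t = 0)
   /\
   (beta <= alpha ->
      (exists2 k : R, k != 0 &
         forall t, continuity_points t0 t1 f t ->
           f t = k / Gamma alpha * (t1 - t) `^ (alpha - beta))
      \/ (forall t, continuity_points t0 t1 f t -> f t = 0))).
Proof.
move=> t01 PCf alpha0 alpha1 beta0; split=> [orth|[lt_ab ge_ab]].
  have [c fc] := orthogonal_proportional PCf alpha0 alpha1 beta0 orth.
  split=> [ab|ba].
    have fc' t : t0 < t < t1 -> continuity_points t0 t1 f t ->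
        c = (t1 - t) `^ (beta - alpha) * f t.
      move=> tt Tt; have ne : t1 - t != 0 by rewrite subr_eq0 gt_eqF//; case/andP: tt.
      by rewrite fc// mulrCA -powRD ?ne ?implybT// subrKA subrr powRr0 mulr1.
    have c0 : c = 0.
      have : (t1 - t) `^ (beta - alpha) * f t @[t --> t1^'-] --> 0 * f t1.
        apply: cvgM; last exact: PC_cvg_left PCf.
        rewrite -(@powR0 R (beta - alpha)) ?subr_eq0 ?gt_eqF// -[X in X `^ _](subrr t1).
        by apply: powR_subr_cvg_left; rewrite subr_ge0 ltW.
      rewrite mul0r => h; apply: (@cvg_unique _ (@Rhausdorff R) (cst c t @[t --> t1^'-])).
        exact: cvg_cst.
      apply: cvg_trans h; apply: near_eq_cvg.
      by apply: filterS (PC_near_left t01 PCf) => t [Tt tt]; rewrite -fc'.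
    (* With c = 0 the exponent is free; 0 replaces alpha - beta, which is negative here, to meet the
       sign condition of [proportional_closed]. *)
    have f0 : forall t, continuity_points t0 t1 f t -> f t = 0 * (t1 - t) `^ 0.
      apply: proportional_closed => // t tt Tt.
      by rewrite fc// c0 !mul0r.
    by move=> t Tt; rewrite f0// mul0r mulr0.
  have {}fc := proportional_closed t01 PCf _ fc; rewrite subr_ge0 in fc.
  have {}fc := fc ba; have G0 := Gamma_gt0 alpha0 alpha1.
  have [c0|c0] := eqVneq c 0; [right|left].
    by move=> t Tt; rewrite fc// c0 mul0r.
  exists (c * Gamma alpha); first by rewrite mulf_neq0// gt_eqF.
  by move=> t Tt; rewrite mulfK ?fc// gt_eqF.
(* Each alternative supplies a constant, c = 0 included. Only t < t1 is asked for: when alpha < beta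
   the condition is void at t1, its factor being 0 there. *)
suff [c fc] : exists c, forall t, t0 < t < t1 -> continuity_points t0 t1 f t ->
    f t = c * (t1 - t) `^ (alpha - beta).
  exact: proportional_orthogonal fc.
have [/lt_ab f0|/ge_ab [[k _ fk]|f0]] := ltP alpha beta.
- exists 0 => t /andP[_ tt1] /f0 /eqP.
  by rewrite mulf_eq0 mul0r powR_eq0 subr_eq0 gt_eqF//= => /eqP.
- by exists (k / Gamma alpha) => t _ /fk.
- by exists 0 => t _ /f0 ->; rewrite mul0r.
Qed.
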